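(* Let $\mathcal X^{+}$ (resp. $\mathcal X^{-}$) be the operad $Dend\,\square\,Dias$ quotiented by the relation $(16+)$ (resp. $(16-)$): $$(\nearrow)\searrow - (\nwarrow)\searrow = +\nwarrow(\swarrow) - \nwarrow(\searrow)\qquad (16+)$$ $$(\nearrow)\searrow - (\nwarrow)\searrow = -\nwarrow(\swarrow) + \nwarrow(\searrow)\qquad (16-)$$ The operad $\mathcal X=\mathcal X^{\pm}$ completes the operadic butterfly, that is, each of $\mathcal X^{+}$ and $\mathcal X^{-}$ satisfies the following properties: (1) the space of binary operations is $8$-dimensional; (2) the operad is isomorphic to its dual (for Koszul duality); (3) a dendriform algebra is an $\mathcal X$-algebra satisfying some symmetry; (4) any $\mathcal X$-algebra gives, by some symmetrization of the operations, a diassociative algebra; (5) the functors deduced from the preceding two items make the upper square of the completed operadic butterfly commutative.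
   Context: All vector spaces are over a field $\mathbb K$. Regular operads. A binary quadratic regular operad $\mathcal P$ is given by binary generating operations $\circ_i$, $i\in I$ (with no symmetry), and relations of the form $\sum_{i,j}\alpha_{ij}(x\circ_i y)\circ_j z=\sum_{i,j}\beta_{ij}\,x\circ_i(y\circ_j z)$ with scalars $\alpha_{ij},\beta_{ij}$ (the variables stay in the same order). A $\mathcal P$-algebra is a vector space with bilinear operations $\circ_i$ satisfying these relations. Let $E$ be the vector space with basis $\{\circ_i\}_{i\in I}$. Write $(\circ_i)\circ_j$ and $\circ_i(\circ_j)$ for the basis elements of $2E\otimes E=(E\otimes E)\oplus(E\otimes E)$ corresponding to $(x\circ_i y)\circ_j z$ and $x\circ_i(y\circ_j z)$ respectively. The space of relations $R\subset 2E\otimes E$ is spanned by the vectors $\sum\alpha_{ij}(\circ_i)\circ_j-\sum\beta_{ij}\circ_i(\circ_j)$. A relation written without variables, such as $(\circ_i)\circ_j=\circ_k(\circ_l)$, means $(x\circ_i y)\circ_j z=x\circ_k(y\circ_l z)$ for all $x,y,z$. The quotient of an operad by a relation is the operad with the same generating operations and with that relation added. The space of $n$-ary operations of $\mathcal P$ is $\mathcal P_n\otimes\mathbb K[S_n]$, where $\mathcal P_n$ is the space of non-symmetric $n$-ary operations; $\mathcal P_2=E$, so the space of binary operations is $E\otimes\mathbb K[S_2]$. Koszul dual. $\mathcal P^!$ is the regular operad with generating operations the dual basis $\circ_i^*$ of $E^*$ (identified with $E$ via $\circ_i^*\leftrightarrow\circ_i$) and space of relations $R^\perp$, the orthogonal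 of $R$ for the bilinear form on $2E\otimes E$ with $\langle(\circ_i)\circ_j,(\circ_i)\circ_j\rangle=1$, $\langle\circ_i(\circ_j),\circ_i(\circ_j)\rangle=-1$, and $0$ on all other pairs of basis elements. $As$: associative algebras. $Dend$ (dendriform algebras): two operations $\wedge,\vee$ with $(x\wedge y)\wedge z=x\wedge(y\wedge z)+x\wedge(y\vee z)$; $(x\vee y)\wedge z=x\vee(y\wedge z)$; $(x\wedge y)\vee z+(x\vee y)\vee z=x\vee(y\vee z)$. $Dias$ (diassociative algebras): two operations $\dashv,\vdash$ with $(x\dashv y)\dashv z=x\dashv(y\dashv z)$; $(x\dashv y)\dashv z=x\dashv(y\vdash z)$; $(x\vdash y)\dashv z=x\vdash(y\dashv z)$; $(x\dashv y)\vdash z=x\vdash(y\vdash z)$; $(x\vdash y)\vdash z=x\vdash(y\vdash z)$. $Dend\,\square\,Dias$: the regular operad with the four generating operations $\nwarrow=(\wedge,\dashv)$, $\nearrow=(\wedge,\vdash)$, $\searrow=(\vee,\vdash)$, $\swarrow=(\vee,\dashv)$ and the 15 relations (products of the 3 relations of $Dend$ with the 5 relations of $Dias$) $$\begin{array}{lll} (\nwarrow)\nwarrow=\nwarrow(\nwarrow)+\nwarrow(\swarrow), & (\swarrow)\nwarrow=\swarrow(\nwarrow), & (\nwarrow)\swarrow+(\swarrow)\swarrow=\swarrow(\swarrow),\\ (\nwarrow)\nwarrow=\nwarrow(\searrow)+\nwarrow(\nearrow), & (\swarrow)\nwarrow=\swarrow(\nearrow), & (\nwarrow)\swarrow+(\swarrow)\swarrow=\swarrow(\searrow),\\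 (\nearrow)\nwarrow=\nearrow(\nwarrow)+\nearrow(\swarrow), & (\searrow)\nwarrow=\searrow(\nwarrow), & (\nearrow)\swarrow+(\searrow)\swarrow=\searrow(\swarrow),\\ (\nwarrow)\nearrow=\nearrow(\nearrow)+\nearrow(\searrow), & (\swarrow)\nearrow=\searrow(\nearrow), & (\nwarrow)\searrow+(\swarrow)\searrow=\searrow(\searrow),\\ (\nearrow)\nearrow=\nearrow(\nearrow)+\nearrow(\searrow), & (\searrow)\nearrow=\searrow(\nearrow), & (\nearrow)\searrow+(\searrow)\searrow=\searrow(\searrow). \end{array}$$ Operadic butterfly. This is a diagram of categories of algebras made of two squares sharing the vertex $As$: one with vertices $Zinb$ (Zinbiel algebras), $Dend$, $Com$ (commutative algebras), $As$, and one with vertices $As$, $Dias$, $Lie$ (Lie algebras), $Leib$ (Leibniz algebras). Completing it means placing a category of $\mathcal X$-algebras above $As$, with arrows $Dend\hookrightarrow\mathcal X$ and $\mathcal X\stackrel{+}{\to}Dias$. An arrow $\mathcal A\hookrightarrow\mathcal B$ means that an $\mathcal A$-algebra is a $\mathcal B$-algebra satisfying some symmetry property; an arrow $\mathcal A\stackrel{\pm}{\to}\mathcal B$ means that any generating operation of a $\mathcal B$-algebra is obtained by some addition (or subtraction) of two operations of the $\mathcal A$-algebra type. The upper square of the completed butterfly has vertices $Dend$, $\mathcal X$, $Dias$, $As$ and arrows $Dend\hookrightarrow\mathcal X$, $\mathcal X\stackrel{+}{\to}Dias$, $Dend\stackrel{+}{\to}As$ (the associative product is the sum of the two dendriform operations)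 and $As\hookrightarrow Dias$ (an associative algebra is a diassociative algebra whose two operations coincide). *)

(* Defs.v *)
From HB Require Import structures.
From mathcomp Require Import all_boot all_order perm all_algebra.
From mathcomp Require Import boolp.
From mathcomp.multinomials Require Import freeg.

Set Implicit Arguments.
Unset Strict Implicit.
Unset Printing Implicit Defensive.

Import GRing.Theory.
Local Open Scope ring_scope.
Local Open Scope quotient_scope.

(* Quotient of a vector space by a subspace: the library provides the
   additive group {quot W}, to which we add the scalar multiplication. *)

Section QuotientModule.
Variables (K : fieldType) (V : lmodType K) (W : zmodClosed V).
Hypothesis W_scale : GRing.scaler_closed W.

Definition quotm of GRing.scaler_closed W := Quotient.quot W.
HB.instance Definition _ := GRing.Zmodule.on (quotm W_scale).
Local Notation Q := (quotm W_scale).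

Definition pim (x : V) : Q := \pi_(Quotient.quot W) x.
Definition reprm (x : Q) : V := repr (x : Quotient.quot W).

Lemma reprmK : cancel reprm pim.
Proof. exact: (@reprK _ (Quotient.quot W)). Qed.

Lemma pim_eq x y : (pim x = pim y) <-> (x - y \in W).
Proof. by rewrite Quotient.idealrBE; split=> /eqP. Qed.

Lemma pimD x y : pim (x + y) = pim x + pim y.
Proof. exact: (@pi_addr _ _ _ _ _ (Quotient.quot W)). Qed.

Definition scaleq (a : K) (x : Q) : Q := pim (a *: reprm x).

Lemma pim_scaleq a x : pim (a *: x) = scaleq a (pim x).
Proof.
apply/pim_eq; rewrite -scalerBr; apply: W_scale.
by apply/pim_eq; rewrite reprmK.
Qed.

Fact scaleqA a b x : scaleq a (scaleq b x) = scaleq (a * b) x.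
Proof. by rewrite -[x]reprmK -!pim_scaleq scalerA. Qed.
Fact scaleq1 : left_id 1 scaleq.
Proof. by move=> x; rewrite -[x]reprmK -pim_scaleq scale1r. Qed.
Fact scaleqDr : right_distributive scaleq +%R.
Proof.
by move=> a x y; rewrite -[x]reprmK -[y]reprmK -pimD -!pim_scaleq scalerDr pimD.
Qed.
Fact scaleqDl x : {morph scaleq^~ x : a b / a + b}.
Proof. by move=> a b; rewrite -[x]reprmK -!pim_scaleq scalerDl pimD. Qed.

HB.instance Definition _ :=
  GRing.Zmodule_isLmodule.Build K Q scaleqA scaleq1 scaleqDr scaleqDl.

Fact pim_is_linear : linear pim.
Proof. by move=> a x y; rewrite pimD pim_scaleq. Qed.
HB.instance Definition _ :=
  GRing.isLinear.Build K V Q *:%R pim pim_is_linear.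

End QuotientModule.

(* Planar binary trees with vertices labelled in I and leaves labelled in L:
   the tree [Node i s t] stands for s o_i t. *)

Inductive tree (I L : Type) : Type :=
| Leaf of L
| Node of I & tree I L & tree I L.
Arguments Leaf {I L}.

Fixpoint leaves (I L : Type) (t : tree I L) : seq L :=
  match t with
  | Leaf x => [:: x]
  | Node _ s t => leaves s ++ leaves t
  end.

Section Trees.
Variables (I : choiceType) (L : choiceType).

Fixpoint tree_encode (t : tree I L) : GenTree.tree (I + L) :=
  match t with
  | Leaf x => GenTree.Leaf (inr x)
  | Node i s t =>
      GenTree.Node 0%N [:: GenTree.Leaf (inl i); tree_encode s; tree_encode t]
  end.

Fixpoint tree_decode (t : GenTree.tree (I + L)) : option (tree I L) :=
  match t with
  | GenTree.Leaf (inr x) => Some (Leaf x)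
  | GenTree.Node _ [:: GenTree.Leaf (inl i); s; t] =>
      if (tree_decode s, tree_decode t) is (Some s', Some t')
      then Some (Node i s' t') else None
  | _ => None
  end.

Lemma tree_encodeK : pcancel tree_encode tree_decode.
Proof. by elim=> //= i s -> t ->. Qed.

HB.instance Definition _ := Choice.copy (tree I L) (pcan_type tree_encodeK).

End Trees.

Fixpoint subst (I L M : Type) (f : L -> tree I M) (t : tree I L) : tree I M :=
  match t with
  | Leaf x => f x
  | Node i s t => Node i (subst f s) (subst f t)
  end.

Lemma leaves_rename (I L M : Type) (f : L -> M) (t : tree I L) :
  leaves (subst (fun x => Leaf (f x)) t) = map f (leaves t).
Proof. by elim: t => //= i s -> t ->; rewrite map_cat. Qed.

Lemma leaves_subst (I L M : Type) (f : L -> tree I M) t :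
  leaves (subst f t) = flatten [seq leaves (f x) | x <- leaves t].
Proof.
by elim: t => /= [x|i s -> t ->]; rewrite ?cats0 // map_cat flatten_cat.
Qed.

Section Monomials.
Local Open Scope nat_scope.

Variable I : choiceType.

(* Multilinear monomials in the variables x_0, ..., x_(n-1). *)
Definition multilinear n (t : tree I nat) := perm_eq (leaves t) (iota 0 n).

Record monomial n := Monomial {
  monomial_val :> tree I nat;
  monomialP : multilinear n monomial_val }.

HB.instance Definition _ n := [isSub for @monomial_val n].
HB.instance Definition _ n := [Choice of monomial n by <:].

Fact var_subproof : multilinear 1 (Leaf 0).
Proof. by []. Qed.
Definition var0 := Monomial var_subproof.

(* The partial composite t o_i s of t(x_0, ..., x_(m-1)) and
   s(x_0, ..., x_(n-1)) is
   t(x_0, ..., x_(i-1), s(x_i, ..., x_(i+n-1)), x_(i+n), ..., x_(m+n-2)). *)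
Definition graft_leaf (m n : nat) (i : 'I_m) (s : tree I nat) (k : nat) :=
  if k < i then Leaf k
  else if k == i then subst (fun l => Leaf (i + l)) s
  else Leaf (k + n).-1.

Fact graft_subproof m n (t : monomial m) (i : 'I_m) (s : monomial n) :
  multilinear (m + n).-1 (subst (graft_leaf n i s) t).
Proof.
have [ile mE] : i <= m /\ m = i + (1 + (m - i.+1)).
  by have im := ltn_ord i; split; [exact: ltnW | rewrite add1n addnS -addSn subnKC].
rewrite /multilinear leaves_subst.
have /(perm_map (fun k => leaves (graft_leaf n i s k)))/perm_flatten := monomialP t.
move=> /perm_trans; apply; rewrite [in iota 0 m]mE !iotaD !map_cat !flatten_cat.
rewrite add0n /= cats0 addn1.
rewrite (_ : leaves (graft_leaf n i s i) = map (addn i) (leaves s)); last first.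
  by rewrite /graft_leaf ltnn eqxx leaves_rename.
have -> : (m + n).-1 = i + (n + (m - i.+1)).
  by rewrite {1}mE add1n addnS addSn /= -addnA [n + _]addnC.
rewrite !iotaD add0n; apply: perm_cat.
  rewrite (_ : flatten _ = iota 0 i) //.
  rewrite -[RHS]flatten_seq1 -?map_comp; congr flatten.
  apply/eq_in_map => k; rewrite mem_iota add0n /= => ki.
  by rewrite /graft_leaf ki.
apply: perm_cat.
  have /(perm_map (addn i)) := monomialP s.
  by rewrite -iotaDl addn0.
rewrite (_ : flatten _ = iota (i + n) (m - i.+1)) //.
rewrite -[RHS]flatten_seq1.
rewrite -[i + n]addn0 -[X in map _ (iota X _)]addn0 !iotaDl -!map_comp; congr flatten.
apply: eq_map => k /=.
by rewrite /graft_leaf addSnnS ltnNge leq_addr -addSnnS gtn_eqF ?leq_addr //= addnAC.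
Qed.
Definition graft m n t i s := Monomial (@graft_subproof m n t i s).

(* t . w is t(x_(w 0), ..., x_(w (n-1))). *)
Definition perm_nat n (w : 'S_n) (k : nat) : nat :=
  if insub k is Some i then val (w i) else k.

Fact rename_subproof n (t : monomial n) (w : 'S_n) :
  multilinear n (subst (fun k => Leaf (perm_nat w k)) t).
Proof.
rewrite /multilinear leaves_rename.
apply: perm_trans (perm_map _ (monomialP t)) _.
have -> : [seq perm_nat w k | k <- iota 0 n] = map val [seq w i | i <- enum 'I_n].
  rewrite -val_enum_ord -!map_comp; apply: eq_map => i /=.
  by rewrite /perm_nat valK.
rewrite -val_enum_ord; apply: perm_map; apply: uniq_perm.
- by rewrite map_inj_uniq ?enum_uniq //; apply: perm_inj.
- exact: enum_uniq.
move=> i; rewrite mem_enum; apply/mapP.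
by exists ((w^-1)%g i); rewrite ?mem_enum ?permKV.
Qed.
Definition rename n t w := Monomial (@rename_subproof n t w).

End Monomials.

Arguments var0 {I}.

(* The space 2E (x) E, where E has basis I: [inl (i, j)] indexes the basis
   vector (o_i)o_j and [inr (i, j)] indexes o_i(o_j). *)

Notation quadratic K I := {ffun (I * I) + (I * I) -> K^o}.

Section Quadratic.
Variables (K : fieldType) (I : finType).
Local Notation QE := (quadratic K I).

Definition lcomp (i j : I) : QE := [ffun q => (q == inl (i, j))%:R].
Definition rcomp (i j : I) : QE := [ffun q => (q == inr (i, j))%:R].

Definition koszul_form (u v : QE) : K :=
  (\sum_p u (inl p) * v (inl p)) - (\sum_p u (inr p) * v (inr p)).

Fact koszul_form_bilinear :
  bilinear_for (GRing.Scale.Law.clone _ _ ( *%R ) _)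
    (GRing.Scale.Law.clone _ _ (@idfun K \; *%R) _) koszul_form.
Proof.
split=> [v|u] a x y; rewrite /koszul_form /= mulrBr addrACA -opprD !mulr_sumr -!big_split.
  by congr (_ - _); apply: eq_bigr => p _; rewrite !ffunE [LHS]mulrDl -mulrA.
by congr (_ - _); apply: eq_bigr => p _; rewrite !ffunE [LHS]mulrDr mulrCA.
Qed.
HB.instance Definition _ :=
  bilinear_isBilinear.Build K QE QE K _ _ koszul_form koszul_form_bilinear.

Fact koszul_form_sym u v :
  koszul_form u v = (-1) ^+ false * idfun (koszul_form v u).
Proof.
by rewrite mul1r; congr (_ - _); apply: eq_bigr => p _; exact: mulrC.
Qed.
HB.instance Definition _ :=
  isHermitianSesquilinear.Build K QE false idfun koszul_form koszul_form_sym.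

End Quadratic.

Record regular_operad (K : fieldType) := RegularOperad {
  gens : finType;
  rels : {vspace quadratic K gens} }.

(* E^* is identified with E by means of the dual basis. *)
Definition koszul_dual K (P : regular_operad K) : regular_operad K :=
  RegularOperad (orthov (@koszul_form K (gens P)) (rels P)).

Definition quotient_operad K (P : regular_operad K)
    (r : quadratic K (gens P)) : regular_operad K :=
  RegularOperad (rels P + <[r]>)%VS.

Section LinearExtension.
Variables (K : nzRingType) (T : choiceType) (M : lmodType K) (f : T -> M).

Lemma fgliftE (D : {freeg T / K}) :
  fglift f D = \sum_(t <- dom D) coeff t D *: f t.
Proof.
rewrite -[in LHS](freeg_sumE D).
pose g := GRing.isZmodMorphism.Build _ _ (fglift f) (lift_is_additive f).
pose h : {additive _ -> _} := HB.pack (fglift f) g.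
by rewrite -[fglift f]/(h : _ -> _) raddf_sum; apply: eq_bigr => t _; exact: liftU.
Qed.

End LinearExtension.

Lemma fglift_linear (K : fieldType) (T : choiceType) (M : lmodType K)
  (f : T -> M) : linear (fglift f).
Proof.
pose g := GRing.isZmodMorphism.Build _ _ (fglift f) (lift_is_additive f).
pose h : {additive _ -> _} := HB.pack (fglift f) g.
move=> a D E; rewrite -[fglift f]/(h : _ -> _) raddfD /=; congr (_ + _).
rewrite -[a *: D]/(fgscale a D) /fgscale -[fglift f]/(h : _ -> _) raddf_sum /=.
rewrite fgliftE scaler_sumr; apply: eq_bigr => t _.
by rewrite liftU scalerA.
Qed.

Section Operad.
Variables (K : fieldType) (P : regular_operad K).
Local Notation I := (gens P).

(* The n-ary component of the free operad on E (x) K[S_2]. *)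
Definition free_op (n : nat) : lmodType K := {freeg (monomial I n) / K}.

Definition free_unit : free_op 1 := << var0 >>.
Definition free_comp m n (x : free_op m) (i : 'I_m) (y : free_op n) :
    free_op (m + n).-1 :=
  fglift (fun t => fglift (fun s => << graft t i s >> : free_op _) y) x.
Definition free_act n (x : free_op n) (w : 'S_n) : free_op n :=
  fglift (fun t => << rename t w >> : free_op n) x.

Fact free_comp_linearl m n i (y : free_op n) :
  linear (fun x : free_op m => free_comp x i y).
Proof. exact: fglift_linear. Qed.

Fact free_comp_linearr m n (x : free_op m) i :
  linear (fun y : free_op n => free_comp x i y).
Proof.
move=> a y y'; rewrite /free_comp !fgliftE scaler_sumr -big_split.
by apply: eq_bigr => t _; rewrite fglift_linear scalerDr !scalerA mulrC.
Qed.

Fact free_act_linear n (w : 'S_n) : linear (fun x => free_act x w).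
Proof. exact: fglift_linear. Qed.

Fact left_monomial_subproof (i j : I) :
  multilinear 3 (Node j (Node i (Leaf 0%N) (Leaf 1%N)) (Leaf 2%N)).
Proof. by []. Qed.
Fact right_monomial_subproof (i j : I) :
  multilinear 3 (Node i (Leaf 0%N) (Node j (Leaf 1%N) (Leaf 2%N))).
Proof. by []. Qed.

Definition free_quad (r : quadratic K I) : free_op 3 :=
  \sum_p r (inl p) *: << Monomial (left_monomial_subproof p.1 p.2) >>
  + \sum_p r (inr p) *: << Monomial (right_monomial_subproof p.1 p.2) >>.

(* The operadic ideal generated by the space of relations. *)
Inductive ideal : forall n, free_op n -> Prop :=
| ideal_rel r : r \in rels P -> ideal (free_quad r)
| ideal0 n : ideal (0 : free_op n)
| ideal_lin n a (x y : free_op n) : ideal x -> ideal y -> ideal (a *: x + y)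
| ideal_compl m n (x : free_op m) i (y : free_op n) :
    ideal x -> ideal (free_comp x i y)
| ideal_compr m n (x : free_op m) i (y : free_op n) :
    ideal y -> ideal (free_comp x i y)
| ideal_act n (x : free_op n) w : ideal x -> ideal (free_act x w).

Definition ideal_pred n : {pred free_op n} := fun x => `[< ideal x >].

Fact ideal_zmod_closed n : zmod_closed (@ideal_pred n).
Proof.
split=> [|x y /asboolP Ix /asboolP Iy]; apply/asboolP; first exact: ideal0.
by rewrite addrC -scaleN1r; apply: ideal_lin.
Qed.
HB.instance Definition _ n :=
  GRing.isZmodClosed.Build (free_op n) (@ideal_pred n) (@ideal_zmod_closed n).

Fact ideal_scaler_closed n : GRing.scaler_closed (@ideal_pred n).
Proof.
move=> a x /asboolP Ix; apply/asboolP.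
by rewrite -[_ *: _]addr0; apply: ideal_lin => //; apply: ideal0.
Qed.

Definition operations n : lmodType K := quotm (@ideal_scaler_closed n).
Definition op_class n (x : free_op n) : operations n := pim _ x.
Definition op_repr n (x : operations n) : free_op n := reprm x.

Definition op_unit : operations 1 := op_class free_unit.
Definition op_comp m n (x : operations m) (i : 'I_m) (y : operations n) :
    operations (m + n).-1 :=
  op_class (free_comp (op_repr x) i (op_repr y)).
Definition op_act n (x : operations n) (w : 'S_n) : operations n :=
  op_class (free_act (op_repr x) w).

Lemma op_classP n (x y : free_op n) :
  op_class x = op_class y <-> ideal (x - y).
Proof. by rewrite pim_eq; split=> /asboolP. Qed.

Lemma op_reprK n : cancel (@op_repr n) (@op_class n).
Proof. exact: reprmK. Qed.

Lemma op_comp_class m n (x : free_op m) i (y : free_op n) :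
  op_comp (op_class x) i (op_class y) = op_class (free_comp x i y).
Proof.
apply/op_classP; set x' := op_repr _; set y' := op_repr _.
have Ix : ideal (x' - x) by apply/op_classP; rewrite op_reprK.
have Iy : ideal (y' - y) by apply/op_classP; rewrite op_reprK.
have -> : free_comp x' i y' - free_comp x i y =
    1 *: free_comp (x' - x) i y' + free_comp x i (y' - y).
  rewrite scale1r ![_ - _ in RHS]addrC -(scaleN1r x) -(scaleN1r y).
  by rewrite free_comp_linearl free_comp_linearr !scaleN1r
             (addrC (- _) (free_comp x' i y')) addrACA addNr addr0.
by apply: ideal_lin; [exact: ideal_compl | exact: ideal_compr].
Qed.

Lemma op_act_class n (x : free_op n) w :
  op_act (op_class x) w = op_class (free_act x w).
Proof.
apply/op_classP; set x' := op_repr _.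
have Ix : ideal (x' - x) by apply/op_classP; rewrite op_reprK.
have -> : free_act x' w - free_act x w = free_act (x' - x) w.
  by rewrite [x' - x]addrC -(scaleN1r x) free_act_linear scaleN1r addrC.
exact: ideal_act.
Qed.

End Operad.

Definition has_dim (K : fieldType) (V : lmodType K) (n : nat) : Prop :=
  exists f : {linear V -> 'rV[K]_n}, bijective f.

Definition operad_iso (K : fieldType) (P Q : regular_operad K) : Prop :=
  exists f : forall n, {linear operations P n -> operations Q n},
  [/\ forall n, bijective (f n),
      f 1%N (op_unit P) = op_unit Q,
      forall m n (x : operations P m) (i : 'I_m) (y : operations P n),
        f (m + n).-1 (op_comp x i y) = op_comp (f m x) i (f n y)
    & forall n (x : operations P n) (w : 'S_n),
        f n (op_act x w) = op_act (f n x) w].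

Section QuadraticEvaluation.
Variables (K : fieldType) (I : finType) (A : lmodType K).

Definition quad_eval (o : I -> A -> A -> A) (r : quadratic K I) (x y z : A) : A :=
  \sum_p r (inl p) *: o p.2 (o p.1 x y) z
  + \sum_p r (inr p) *: o p.1 x (o p.2 y z).

Lemma quad_evalD o r s x y z :
  quad_eval o (r + s) x y z = quad_eval o r x y z + quad_eval o s x y z.
Proof.
rewrite /quad_eval addrACA; congr (_ + _); rewrite -big_split;
  by apply: eq_bigr => p _; rewrite ffunE scalerDl.
Qed.

Lemma quad_evalZ o a r x y z :
  quad_eval o (a *: r) x y z = a *: quad_eval o r x y z.
Proof.
rewrite /quad_eval scalerDr !scaler_sumr.
by congr (_ + _); apply: eq_bigr => p _; rewrite ffunE scalerA.
Qed.

Lemma quad_evalN o r x y z : quad_eval o (- r) x y z = - quad_eval o r x y z.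
Proof. by rewrite -[- r]scaleN1r quad_evalZ scaleN1r. Qed.

Lemma quad_eval_lcomp o i j x y z :
  quad_eval o (lcomp K i j) x y z = o j (o i x y) z.
Proof.
rewrite /quad_eval (bigD1 (i, j)) //= !ffunE eqxx scale1r !big1 ?addr0 //.
  by move=> p _; rewrite ffunE scale0r.
move=> p pij; rewrite ffunE (inj_eq (@inl_inj _ _)) (negPf pij) scale0r //.
Qed.

Lemma quad_eval_rcomp o i j x y z :
  quad_eval o (rcomp K i j) x y z = o i x (o j y z).
Proof.
rewrite /quad_eval addrC (bigD1 (i, j)) //= !ffunE eqxx scale1r !big1 ?addr0 //.
  by move=> p _; rewrite ffunE scale0r.
move=> p pij; rewrite ffunE (inj_eq (@inr_inj _ _)) (negPf pij) scale0r //.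
Qed.

Lemma quad_eval_span o (rs : seq (quadratic K I)) x y z :
  (forall r, r \in rs -> quad_eval o r x y z = 0) ->
  forall r, r \in <<rs>>%VS -> quad_eval o r x y z = 0.
Proof.
move=> rs0 r /(@coord_span _ _ _ (in_tuple rs)) ->.
elim/big_rec: _ => [|i s _ IH].
  by rewrite -(scale0r 0) quad_evalZ scale0r.
by rewrite quad_evalD quad_evalZ rs0 ?mem_nth // scaler0 add0r.
Qed.

End QuadraticEvaluation.

Record algebra (K : fieldType) (P : regular_operad K) (A : lmodType K) := Algebra {
  op :> gens P -> A -> A -> A;
  op_bilinear : forall i, bilinear_for *:%R *:%R (op i);
  op_rel : forall r, r \in rels P -> forall x y z, quad_eval op r x y z = 0 }.

Section AlgebraTheory.
Variables (K : fieldType) (P : regular_operad K) (A : lmodType K).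
Variables (a : algebra P A) (i : gens P).

Lemma op_addl x y z : a i (x + y) z = a i x z + a i y z.
Proof. by have [/(_ z 1 x y)/= + _] := op_bilinear a i; rewrite !scale1r. Qed.

Lemma op_addr x y z : a i x (y + z) = a i x y + a i x z.
Proof. by have [_ /(_ x 1 y z)/=] := op_bilinear a i; rewrite !scale1r. Qed.

End AlgebraTheory.

Definition alg_morphism (K : fieldType) (P : regular_operad K) (A B : lmodType K)
    (a : algebra P A) (b : algebra P B) (f : {linear A -> B}) : Prop :=
  forall i x y, f (a i x y) = b i (f x) (f y).

(* Functors between categories of algebras which do not change the underlying
   vector spaces and linear maps, as are all the arrows of the butterfly. *)
Record alg_functor (K : fieldType) (P Q : regular_operad K) := AlgFunctor {
  fun_alg :> forall A : lmodType K, algebra P A -> algebra Q A;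
  fun_morphism : forall (A B : lmodType K) (a : algebra P A) (b : algebra P B)
    (f : {linear A -> B}),
    alg_morphism a b f -> alg_morphism (fun_alg a) (fun_alg b) f }.

Definition comp_functor (K : fieldType) (P Q R : regular_operad K)
    (G : alg_functor Q R) (F : alg_functor P Q) : alg_functor P R :=
  AlgFunctor (fun A B a b f fm => fun_morphism G (fun_morphism F fm)).

Definition eq_functor (K : fieldType) (P Q : regular_operad K)
    (F G : alg_functor P Q) : Prop :=
  forall (A : lmodType K) (a : algebra P A) i x y, F A a i x y = G A a i x y.

Section Arrows.
Variables (K : fieldType) (P Q : regular_operad K).

(* The binary operation x o_i y, or y o_i x when [flip] holds. *)
Definition swop (A : lmodType K) (a : algebra P A) (i : gens P) (flip : bool)
    (x y : A) : A :=
  if flip then a i y x else a i x y.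

(* Symmetry properties of P-algebras: identities of the form
   x o_i y = +- x o_j y or x o_i y = +- y o_j x, such as x o_1 y = y o_2 x for
   Zinbiel algebras among dendriform ones, or [x, y] = - [y, x] for Lie
   algebras among Leibniz ones. *)
Record symmetry (I : Type) := Symmetry {
  sym_lhs : I; sym_rhs : I; sym_swap : bool; sym_neg : bool }.

Definition symmetric (A : lmodType K) (a : algebra P A)
    (s : symmetry (gens P)) : Prop :=
  forall x y : A,
    a (sym_lhs s) x y = (-1) ^+ sym_neg s *: swop a (sym_rhs s) (sym_swap s) x y.

End Arrows.

(* The hooked arrow from P to Q: the functor F identifies the category of
   P-algebras with the full subcategory of the Q-algebras having some
   symmetries. *)
Definition inclusion_arrow (K : fieldType) (P Q : regular_operad K)
    (F : alg_functor P Q) : Prop :=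
  (forall (A B : lmodType K) (a : algebra P A) (b : algebra P B)
     (f : {linear A -> B}),
     alg_morphism (F A a) (F B b) f -> alg_morphism a b f)
  /\ exists S : symmetry (gens Q) -> Prop,
     forall (A : lmodType K) (b : algebra Q A),
       (forall s, S s -> symmetric b s)
       <-> exists a : algebra P A, forall i x y, F A a i x y = b i x y.

(* The arrow from P to Q labelled +: each generating operation of the Q-algebra
   G(A) is a sum of two distinct binary operations of the P-algebra A. *)
Definition addition_arrow (K : fieldType) (P Q : regular_operad K)
    (G : alg_functor P Q) : Prop :=
  forall j : gens Q, exists (i1 i2 : gens P) (flip1 flip2 : bool),
    (i1, flip1) != (i2, flip2) /\
    forall (A : lmodType K) (a : algebra P A) (x y : A),
      G A a j x y = swop a i1 flip1 x y + swop a i2 flip2 x y.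

Definition As_mul : unit := tt.
Definition wedge : bool := false.
Definition vee : bool := true.
Definition ldias : bool := false. (* -| *)
Definition rdias : bool := true.  (* |- *)
Definition nw : bool * bool := (wedge, ldias).
Definition ne : bool * bool := (wedge, rdias).
Definition se : bool * bool := (vee, rdias).
Definition sw : bool * bool := (vee, ldias).

Section Operads.
Variable K : fieldType.
Local Notation L i j := (lcomp K i j).
Local Notation R i j := (rcomp K i j).

Definition As : regular_operad K := @RegularOperad K unit
  <<[:: L As_mul As_mul - R As_mul As_mul]>>%VS.

Definition Dend : regular_operad K := @RegularOperad K bool
  <<[:: L wedge wedge - (R wedge wedge + R wedge vee);
        L vee wedge - R vee wedge;
        (L wedge vee + L vee vee) - R vee vee]>>%VS.

Definition Dias : regular_operad K := @RegularOperad K bool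
  <<[:: L ldias ldias - R ldias ldias;
        L ldias ldias - R ldias rdias;
        L rdias ldias - R rdias ldias;
        L ldias rdias - R rdias rdias;
        L rdias rdias - R rdias rdias]>>%VS.

Definition DendDias : regular_operad K := @RegularOperad K (bool * bool)%type
  <<[:: L nw nw - (R nw nw + R nw sw);
        L sw nw - R sw nw;
        (L nw sw + L sw sw) - R sw sw;

        L nw nw - (R nw se + R nw ne);
        L sw nw - R sw ne;
        (L nw sw + L sw sw) - R sw se;

        L ne nw - (R ne nw + R ne sw);
        L se nw - R se nw;
        (L ne sw + L se sw) - R se sw;

        L nw ne - (R ne ne + R ne se);
        L sw ne - R se ne;
        (L nw se + L sw se) - R se se;

        L ne ne - (R ne ne + R ne se);
        L se ne - R se ne;
        (L ne se + L se se) - R se se]>>%VS.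

Definition Xplus : regular_operad K := @quotient_operad K DendDias
  ((L ne se - L nw se) - (R nw sw - R nw se)).

Definition Xminus : regular_operad K := @quotient_operad K DendDias
  ((L ne se - L nw se) - (- R nw sw + R nw se)).

Section DendAs.
Variables (A : lmodType K) (a : algebra Dend A).

Definition sum_op (i : unit) (x y : A) : A := a wedge x y + a vee x y.

Fact sum_op_bilinear i : bilinear_for *:%R *:%R (sum_op i).
Proof.
have [wl wr] := op_bilinear a wedge; have [vl vr] := op_bilinear a vee.
split=> [v|u] c x y; rewrite /sum_op /= scalerDr addrACA.
  by congr (_ + _); [exact: wl | exact: vl].
by congr (_ + _); [exact: wr | exact: vr].
Qed.

Fact sum_op_rel r : r \in rels As -> forall x y z, quad_eval sum_op r x y z = 0.
Proof.
move=> rAs x y z; apply: quad_eval_span rAs => {}r; rewrite inE => /eqP ->.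
have rel r' : r' \in _ -> _ := fun h => @op_rel _ _ _ a r' (memv_span h) x y z.
have := rel (L wedge wedge - (R wedge wedge + R wedge vee)).
have := rel (L vee wedge - R vee wedge).
have := rel ((L wedge vee + L vee vee) - R vee vee).
rewrite !inE !eqxx ?orbT /=.
rewrite !(quad_evalD, quad_evalN, quad_eval_lcomp, quad_eval_rcomp).
move=> /(_ isT)/subr0_eq r3 /(_ isT)/subr0_eq r2 /(_ isT)/subr0_eq r1.
apply/eqP; rewrite subr_eq0 /sum_op; apply/eqP.
by rewrite !op_addl !op_addr r1 r2 r3 -!addrA.
Qed.

Definition Dend_As_alg : algebra As A :=
  @Algebra K As A sum_op sum_op_bilinear sum_op_rel.

End DendAs.

Fact Dend_As_morphism (A B : lmodType K) (a : algebra Dend A)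
  (b : algebra Dend B) (f : {linear A -> B}) :
  alg_morphism a b f -> alg_morphism (Dend_As_alg a) (Dend_As_alg b) f.
Proof. by move=> fm i x y; rewrite /= /sum_op linearD !fm. Qed.

Definition Dend_As : alg_functor Dend As := AlgFunctor Dend_As_morphism.

Section AsDias.
Variables (A : lmodType K) (a : algebra As A).

Definition same_op (i : bool) (x y : A) : A := a As_mul x y.

Fact same_op_bilinear i : bilinear_for *:%R *:%R (same_op i).
Proof. exact: op_bilinear. Qed.

Fact same_op_rel r :
  r \in rels Dias -> forall x y z, quad_eval same_op r x y z = 0.
Proof.
move=> rD x y z; apply: quad_eval_span rD => {}r.
have := op_rel a (memv_span (mem_head _ _)) x y z.
rewrite quad_evalD quad_evalN quad_eval_lcomp quad_eval_rcomp => assoc.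
by rewrite !inE => /or4P[||| /orP[]] /eqP ->;
  rewrite quad_evalD quad_evalN quad_eval_lcomp quad_eval_rcomp.
Qed.

Definition As_Dias_alg : algebra Dias A :=
  @Algebra K Dias A same_op same_op_bilinear same_op_rel.

End AsDias.

Fact As_Dias_morphism (A B : lmodType K) (a : algebra As A)
  (b : algebra As B) (f : {linear A -> B}) :
  alg_morphism a b f -> alg_morphism (As_Dias_alg a) (As_Dias_alg b) f.
Proof. by move=> fm i x y; rewrite /= /same_op fm. Qed.

Definition As_Dias : alg_functor As Dias := AlgFunctor As_Dias_morphism.

End Operads.

(* Main.v *)
From HB Require Import structures.
Require Import Defs.
From mathcomp Require Import all_boot all_order perm all_algebra.
From mathcomp Require Import boolp ring.
From mathcomp.multinomials Require Import freeg.

(* Let s be the exchange of ne and sw, fixing nw and se, and R the space of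
   relations. Solving the sixteen linear equations which define the orthogonal
   of R, one finds that the image by s of a solution is a combination of the
   sixteen relators, so s maps the orthogonal of R into R. As R is spanned by
   16 vectors in dimension 32, dim R <= 16 <= dim R^perp; hence s maps the
   orthogonal onto R, and it induces an isomorphism with the Koszul dual.
   Dendriform algebras are the algebras in which nw = ne and sw = se, and the
   sums nw + sw and ne + se are the two diassociative products. *)

Set Implicit Arguments.
Unset Strict Implicit.
Unset Printing Implicit Defensive.

Import GRing.Theory.
Local Open Scope ring_scope.

(** * Linear extension of maps to free modules *)

Section FreeModule.
Variables (K : fieldType) (T : choiceType).

Lemma eq_fglift (M : lmodType K) (f g : T -> M) : f =1 g -> fglift f =1 fglift g.
Proof. by move=> fg x; rewrite !fgliftE; apply: eq_bigr => t _; rewrite fg. Qed.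

Lemma fglift_sum (M : lmodType K) (f : T -> M) (I : Type) (r : seq I)
    (c : I -> K) (x : I -> {freeg T / K}) :
  fglift f (\sum_(i <- r) c i *: x i) = \sum_(i <- r) c i *: fglift f (x i).
Proof.
elim: r => [|i r IH]; last by rewrite !big_cons fglift_linear IH.
by rewrite !big_nil fgliftE dom0 big_nil.
Qed.

Lemma fgliftU (M : lmodType K) (f : T -> M) t : fglift f << t >> = f t.
Proof. by rewrite liftU scale1r. Qed.

Lemma fglift_id (x : {freeg T / K}) : fglift (fun t => << t >>) x = x.
Proof.
rewrite fgliftE -[RHS]freeg_sumE; apply: eq_bigr => t _.
by apply/eqP/freeg_eqP => u; rewrite coeffZ !coeffU mul1r.
Qed.

End FreeModule.

(** Merging nested extensions reduces identities between operadic composites to identities between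
    monomials. *)
Lemma fglift_fglift (K : fieldType) (T U : choiceType) (M : lmodType K)
    (g : U -> M) (f : T -> {freeg U / K}) x :
  fglift g (fglift f x) = fglift (fun t => fglift g (f t)) x.
Proof. by rewrite [fglift f x]fgliftE fglift_sum -fgliftE. Qed.

(** * Relabelling of generators and the isomorphisms of operads it induces *)

Fixpoint map_ops (I J L : Type) (s : I -> J) (t : tree I L) : tree J L :=
  match t with
  | Leaf x => Leaf x
  | Node i t u => Node (s i) (map_ops s t) (map_ops s u)
  end.

Lemma leaves_map_ops (I J L : Type) (s : I -> J) (t : tree I L) :
  leaves (map_ops s t) = leaves t.
Proof. by elim: t => //= i t -> u ->. Qed.

Lemma map_opsK (I J L : Type) (s : I -> J) (s' : J -> I) :
  cancel s s' -> cancel (@map_ops I J L s) (map_ops s').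
Proof. by move=> sK; elim=> //= i t -> u ->; rewrite sK. Qed.

Lemma map_ops_subst (I J L M : Type) (s : I -> J) (f : L -> tree I M) t :
  map_ops s (subst f t) = subst (fun x => map_ops s (f x)) (map_ops s t).
Proof. by elim: t => //= i t -> u ->. Qed.

Lemma eq_subst (I L M : Type) (f g : L -> tree I M) :
  f =1 g -> subst f =1 subst g.
Proof. by move=> fg; elim=> //= i t -> u ->. Qed.

Section RelabelMonomial.
Variables (I J : choiceType) (s : I -> J).

Fact relabel_subproof n (t : monomial I n) : multilinear n (map_ops s t).
Proof. by rewrite /multilinear leaves_map_ops; exact: monomialP. Qed.
Definition relabel n (t : monomial I n) := Monomial (relabel_subproof t).

Lemma relabel_graft m n (t : monomial I m) i (u : monomial I n) :
  relabel (graft t i u) = graft (relabel t) i (relabel u).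
Proof.
apply: val_inj; rewrite /= map_ops_subst; apply: eq_subst => k.
rewrite /graft_leaf; case: ifP => // _; case: ifP => // _.
by rewrite map_ops_subst.
Qed.

Lemma relabel_rename n (t : monomial I n) w :
  relabel (rename t w) = rename (relabel t) w.
Proof. by apply: val_inj; rewrite /= map_ops_subst. Qed.

End RelabelMonomial.

Lemma relabelK (I J : choiceType) (s : I -> J) (s' : J -> I) n :
  cancel s s' -> cancel (@relabel I J s n) (@relabel J I s' n).
Proof. by move=> sK t; apply: val_inj; exact: map_opsK. Qed.

(** A quadratic vector is its coordinate function, so transport along a bijection from [I] to [J] is
    precomposition with the inverse [s']. *)
Definition relabel_quad (K : fieldType) (I J : finType) (s' : J -> I)
    (r : quadratic K I) : quadratic K J :=
  [ffun q => r (match q with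
                | inl p => inl (s' p.1, s' p.2)
                | inr p => inr (s' p.1, s' p.2)
                end)].

Section RelabelQuad.
Variables (K : fieldType) (I J : finType).

Fact relabel_quad_linear (s : J -> I) : linear (@relabel_quad K I J s).
Proof. by move=> a u v; apply/ffunP => q; rewrite !ffunE. Qed.
HB.instance Definition _ s :=
  GRing.isLinear.Build K _ _ _ (@relabel_quad K I J s) (@relabel_quad_linear s).

Lemma relabel_quadK (s : J -> I) (s' : I -> J) :
  cancel s' s -> cancel (@relabel_quad K I J s) (relabel_quad s').
Proof. by move=> s'K r; apply/ffunP => -[] [i j]; rewrite !ffunE /= !s'K. Qed.

End RelabelQuad.

Section RelabelOperad.
Variables (K : fieldType) (P Q : regular_operad K).
Variables (s : gens P -> gens Q) (s' : gens Q -> gens P).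
Hypotheses (sK : cancel s s') (s'K : cancel s' s).

Definition relabel_op n (x : free_op P n) : free_op Q n :=
  fglift (fun t => << relabel s t >> : free_op Q n) x.

Lemma relabel_op_linear n : linear (@relabel_op n).
Proof. exact: fglift_linear. Qed.

Lemma relabel_op_comp m n (x : free_op P m) i (y : free_op P n) :
  relabel_op (free_comp x i y) = free_comp (relabel_op x) i (relabel_op y).
Proof.
rewrite /relabel_op /free_comp !fglift_fglift; apply: eq_fglift => t.
rewrite fgliftU !fglift_fglift; apply: eq_fglift => u.
by rewrite !fgliftU relabel_graft.
Qed.

Lemma relabel_op_act n (x : free_op P n) w :
  relabel_op (free_act x w) = free_act (relabel_op x) w.
Proof.
rewrite /relabel_op /free_act !fglift_fglift; apply: eq_fglift => t.
by rewrite !fgliftU relabel_rename.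
Qed.

Lemma relabel_op_unit : relabel_op (free_unit P) = free_unit Q.
Proof.
by rewrite /relabel_op fgliftU; congr (<< _ >>); apply: val_inj.
Qed.

(** Each ternary monomial goes to the one with relabelled vertices; the sum over pairs of generators
    of [Q] is reindexed by the bijection that [s] induces on pairs. *)
Lemma relabel_op_quad r : relabel_op (free_quad r) = free_quad (relabel_quad s' r).
Proof.
have bij2 : bijective (fun p : gens P * gens P => (s p.1, s p.2)).
  by exists (fun p => (s' p.1, s' p.2)) => -[i j]; rewrite /= ?sK ?s'K.
rewrite /relabel_op /free_quad -[X in X + _]scale1r fglift_linear scale1r !fglift_sum.
congr (_ + _); rewrite [RHS](reindex _ (onW_bij _ bij2)); apply: eq_bigr => -[i j] _;
  rewrite ffunE /= !sK fgliftU; congr (_ *: << _ >>); exact: val_inj.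
Qed.

(** Relabelling commutes with composition, with permutations and with linear combinations, so only
    the generating relations have to be compared. *)
Lemma relabel_op_ideal :
  (forall r, r \in rels P -> relabel_quad s' r \in rels Q) ->
  forall n (x : free_op P n), ideal x -> ideal (relabel_op x).
Proof.
move=> PQ n x; elim=>
  {n x} [r Pr|n|n a x y _ IHx _ IHy|m n x i y _ IH|m n x i y _ IH|n x w _ IH].
- by rewrite relabel_op_quad; apply: ideal_rel; apply: PQ.
- rewrite /relabel_op fgliftE dom0 big_nil; exact: ideal0.
- by rewrite relabel_op_linear; apply: ideal_lin.
- by rewrite relabel_op_comp; apply: ideal_compl.
- by rewrite relabel_op_comp; apply: ideal_compr.
- by rewrite relabel_op_act; apply: ideal_act.
Qed.

End RelabelOperad.

Lemma relabel_opK (K : fieldType) (P Q : regular_operad K) s s' n :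
  cancel s s' -> cancel (@relabel_op K P Q s n) (@relabel_op K Q P s' n).
Proof.
move=> sK x; rewrite /relabel_op fglift_fglift -[RHS]fglift_id.
by apply: eq_fglift => t; rewrite fgliftU relabelK.
Qed.

Section RelabelOperations.
Variables (K : fieldType) (P Q : regular_operad K) (s : gens P -> gens Q).

Definition preserves_ideal :=
  forall n (x : free_op P n), ideal x -> ideal (relabel_op s x).
Hypothesis s_ideal : preserves_ideal.

(** The proof of [preserves_ideal] is an argument so that the linear structure declared below, which
    depends on it, can be inferred from the term. *)
Definition relabel_operations of preserves_ideal :=
  fun n (x : operations P n) => op_class (relabel_op s (op_repr x)) : operations Q n.

Lemma relabel_operations_class n (x : free_op P n) :
  relabel_operations s_ideal (op_class x) = op_class (relabel_op s x).
Proof.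
apply/op_classP; set x' := op_repr _.
have -> : relabel_op s x' - relabel_op s x = relabel_op s (x' - x).
  by rewrite addrC -scaleN1r -relabel_op_linear scaleN1r addrC.
by apply: s_ideal; apply/op_classP; rewrite op_reprK.
Qed.

Fact relabel_operations_linear n : linear (relabel_operations s_ideal (n := n)).
Proof.
move=> a x y; rewrite -[x]op_reprK -[y]op_reprK.
have lin := linearP (@pim _ _ _ (@ideal_scaler_closed K _ n)).
rewrite /op_class -lin -/(op_class _) !relabel_operations_class.
by rewrite relabel_op_linear /op_class lin.
Qed.
HB.instance Definition _ n :=
  GRing.isLinear.Build K _ _ _ _ (@relabel_operations_linear n).

End RelabelOperations.

(** The relabellings by [s] and [s'] are mutually inverse morphisms of free operads, and each maps
    ideal into ideal; hence both descend to the quotients. *)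
Theorem operad_iso_relabel (K : fieldType) (P Q : regular_operad K)
    (s : gens P -> gens Q) (s' : gens Q -> gens P) :
  cancel s s' -> cancel s' s ->
  (forall r, r \in rels P -> relabel_quad s' r \in rels Q) ->
  (forall r, r \in rels Q -> relabel_quad s r \in rels P) ->
  operad_iso P Q.
Proof.
move=> sK s'K /(relabel_op_ideal sK s'K) PQ /(relabel_op_ideal s'K sK) QP.
exists (fun n => relabel_operations PQ (n := n)).
split=> [n||m n x i y|n x w] /=.
- exists (relabel_operations QP (n := n)) => x; rewrite -[x]op_reprK;
    by rewrite !relabel_operations_class ?relabel_opK.
- by rewrite relabel_operations_class // relabel_op_unit.
- rewrite -[x]op_reprK -[y]op_reprK op_comp_class !relabel_operations_class //.
  by rewrite relabel_op_comp op_comp_class.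
- rewrite -[x]op_reprK op_act_class !relabel_operations_class //.
  by rewrite relabel_op_act op_act_class.
Qed.

(** * The space of binary operations *)

Lemma size_leaves_gt0 (I L : Type) (t : tree I L) : (0 < size (leaves t))%N.
Proof. by elim: t => //= i t IH u _; rewrite size_cat ltn_addr. Qed.

Lemma leaves_size1 (I L : Type) (t : tree I L) :
  size (leaves t) = 1%N -> exists x, t = Leaf x.
Proof.
case: t => [x|i s t /=]; first by exists x.
rewrite size_cat; have := size_leaves_gt0 s; have := size_leaves_gt0 t.
by case: (size (leaves s)) (size (leaves t)) => [|[|m]] [|n].
Qed.

Lemma size_multilinear (I : choiceType) n (t : monomial I n) :
  size (leaves t) = n.
Proof. by rewrite (perm_size (monomialP t)) size_iota. Qed.

Lemma free_op0 (K : fieldType) (P : regular_operad K) (x : free_op P 0) : x = 0.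
Proof.
apply/eqP/freeg_eqP => t.
by have := size_leaves_gt0 t; rewrite size_multilinear.
Qed.

Lemma fglift0 (K : fieldType) (T : choiceType) (M : lmodType K) (f : T -> M) :
  fglift f 0 = 0.
Proof. by rewrite fgliftE dom0 big_nil. Qed.

Lemma free_comp0r (K : fieldType) (P : regular_operad K) m n (x : free_op P m) i :
  free_comp x i (0 : free_op P n) = 0.
Proof.
by rewrite /free_comp fgliftE big1 // => t _; rewrite fglift0 scaler0.
Qed.

(* The relations are ternary and there are no nullary operations, so no
   composite can bring a relation down to arity 2. *)
Lemma ideal_le2 (K : fieldType) (P : regular_operad K) n (x : free_op P n) :
  ideal x -> (n <= 2)%N -> x = 0.
Proof.
elim=> {n x} [//|//|n a x y _ IHx _ IHy|m n x i y _ IH|m n x i y _ IH|n x w _ IH] n2.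
- by rewrite IHx ?IHy ?scaler0 ?addr0.
(* With [y] nullary the composite has arity m - 1, which would allow m = 3, but such a [y] is 0.
   Otherwise m is at most the arity of the composite. *)
- case: n => [|n] in y n2 *; first by rewrite (free_op0 y) free_comp0r.
  by rewrite IH ?[free_comp _ _ _]fglift0 // (leq_trans _ n2) // addnS leq_addr.
(* As [i] lies in ['I_m], m is positive, so n is at most the arity of the composite. *)
- rewrite IH ?free_comp0r // (leq_trans _ n2) //.
  by case: m i x n2 => [[]//|m] i x _; rewrite addSn leq_addl.
- by rewrite IH ?[free_act _ _]fglift0.
Qed.

Section BinaryMonomials.
Variable I : choiceType.

Fact binary_monomial_subproof (p : I * bool) :
  multilinear 2 (Node p.1 (Leaf (nat_of_bool p.2)) (Leaf (nat_of_bool (~~ p.2)))).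
Proof. by case: p => i []. Qed.
(** The boolean encodes the element of S_2, [true] being the transposition; these monomials form the
    usual basis of E (x) K[S_2]. *)
Definition binary_monomial p := Monomial (binary_monomial_subproof p).

Lemma binary_monomial_inj : injective binary_monomial.
Proof. by move=> [i a] [j b] /(congr1 val) [-> + _]; case: a; case: b. Qed.

Lemma binary_monomialP (t : monomial I 2) : exists p, t = binary_monomial p.
Proof.
case: t => [[x|i s t]] tP; first by have := perm_size tP.
have [/leaves_size1[a sE] /leaves_size1[b tE]] :
    size (leaves s) = 1%N /\ size (leaves t) = 1%N.
  have := perm_size tP; rewrite /= size_cat.
  have := size_leaves_gt0 s; have := size_leaves_gt0 t.
  by case: (size (leaves s)) (size (leaves t)) => [|[|[|m]]] [|[|n]].
move: tP; rewrite {s}sE {t}tE => tP.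
(* The two labels are distinct and belong to {0, 1}, which leaves two orders. *)
have := perm_mem tP a; have := perm_mem tP b; have := perm_uniq tP.
rewrite /= !inE !eqxx ?orbT andbT.
case: a b tP => [|[|a]] [|[|b]] // tP _ _ _; [exists (i, false)|exists (i, true)];
  exact: val_inj.
Qed.

End BinaryMonomials.

(** By [ideal_le2] the ideal is zero in arity 2, so classes have a single representative, and its
    coordinates on the binary monomials give the isomorphism. *)
Lemma has_dim_operations2 (K : fieldType) (P : regular_operad K) :
  has_dim (operations P 2) #|{: gens P * bool}|.
Proof.
set N := #|_|; pose b (j : 'I_N) := binary_monomial (enum_val j).
have b_inj : injective b by move=> j k /binary_monomial_inj/enum_val_inj.
have op_reprE (x : free_op P 2) : op_repr (op_class x) = x.
  apply/eqP; rewrite -subr_eq0; apply/eqP/ideal_le2 => //.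
  by apply/op_classP; rewrite op_reprK.
pose f (x : operations P 2) : 'rV[K]_N := \row_j coeff (b j) (op_repr x).
have f_linear : linear f.
  have lin := linearP (@pim _ _ _ (@ideal_scaler_closed K P 2)).
  move=> a x y; apply/rowP => j; rewrite -[x]op_reprK -[y]op_reprK /op_class -lin.
  by rewrite -!/(op_class _) !mxE !op_reprE coeffD coeffZ.
pose F := GRing.isLinear.Build K _ _ _ f f_linear.
pose fl : {linear operations P 2 -> 'rV[K]_N} := HB.pack f F.
exists fl; exists (fun r : 'rV[K]_N => op_class (\sum_j r 0 j *: << b j >>)).
- move=> x; rewrite -[RHS]op_reprK; congr op_class.
  apply/eqP/freeg_eqP => t.
  have [p ->] := binary_monomialP t; rewrite raddf_sum /=.
  rewrite (bigD1 (enum_rank p)) //= coeffZ coeffU mxE /b enum_rankK eqxx !mulr1.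
  rewrite big1 ?addr0 // => j jp; rewrite coeffZ coeffU -[p in _ == _ p]enum_rankK.
  by rewrite (inj_eq b_inj) (negPf jp) mulr0 mulr0.
- move=> r; apply/rowP => j; rewrite mxE op_reprE raddf_sum /= (bigD1 j) //=.
  rewrite coeffZ coeffU eqxx !mulr1 big1 ?addr0 // => k kj.
  by rewrite coeffZ coeffU (inj_eq b_inj) (negPf kj) !mulr0.
Qed.

(** * The Koszul form, orthogonals of spans and their dimension *)

Section KoszulForm.
Variables (K : fieldType) (I : finType).
Implicit Types u v : quadratic K I.

Lemma koszul_formD u v w :
  koszul_form u (v + w) = koszul_form u v + koszul_form u w.
Proof. exact: linearDr. Qed.

Lemma koszul_formZ u a v : koszul_form u (a *: v) = a * koszul_form u v.
Proof. exact: linearZr_LR. Qed.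

Lemma koszul_form_lcomp u i j : koszul_form u (lcomp K i j) = u (inl (i, j)).
Proof.
rewrite /koszul_form (bigD1 (i, j)) //= ffunE eqxx mulr1 !big1 ?addr0 ?subr0 //.
  by move=> p _; rewrite ffunE mulr0.
by move=> p pij; rewrite ffunE (inj_eq (@inl_inj _ _)) (negPf pij) mulr0.
Qed.

Lemma koszul_form_rcomp u i j : koszul_form u (rcomp K i j) = - u (inr (i, j)).
Proof.
rewrite /koszul_form [X in _ - X](bigD1 (i, j)) //= ffunE eqxx mulr1.
rewrite !big1 ?addr0 ?sub0r //.
  by move=> p pij; rewrite ffunE (inj_eq (@inr_inj _ _)) (negPf pij) mulr0.
by move=> p _; rewrite ffunE mulr0.
Qed.

End KoszulForm.

Lemma orthov_spanP (K : fieldType) (I : finType) u (rs : seq (quadratic K I)) :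
  reflect {in rs, forall r, koszul_form u r = 0}
    (u \in orthov (@koszul_form K I) <<rs>>).
Proof.
apply: (iffP mem_orthovP) => rs0 r; first by move=> /memv_span/rs0.
move=> /(@coord_span _ _ _ (in_tuple rs)) ->; rewrite linear_sumr big1 //= => i _.
by rewrite koszul_formZ rs0 ?mulr0 // mem_nth.
Qed.

(** With combinations written by [zip], membership in a span is proved by exhibiting a list of
    coefficients. *)
Lemma memv_span_comb (K : fieldType) (V : vectType K) (c : seq K) (rs : seq V) :
  \sum_(p <- zip c rs) p.1 *: p.2 \in <<rs>>%VS.
Proof.
elim: rs c => [|r rs IH] [|a c]; rewrite ?big_nil ?mem0v // big_cons span_cons.
by apply: memv_add; rewrite ?memvZ ?memv_line ?IH.
Qed.

Lemma linear_morphs (K : fieldType) (V W : lmodType K) (f : V -> W) :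
  linear f ->
  [/\ {morph f : u v / u + v}, {morph f : u / - u}
    & forall a, {morph f : u / a *: u}].
Proof.
move=> f_lin; pose F := GRing.isLinear.Build K _ _ _ f f_lin.
pose fl : {linear V -> W} := HB.pack f F.
by split; [exact: linearD fl|exact: linearN fl|exact: linearZZ fl].
Qed.

Lemma linear_comb (K : fieldType) (V W : lmodType K) (f : V -> W)
    (c : seq K) (s : seq V) : linear f ->
  f (\sum_(p <- zip c s) p.1 *: p.2) = \sum_(p <- zip c (map f s)) p.1 *: p.2.
Proof.
move=> f_lin; have [_ _ fZ] := linear_morphs f_lin.
have f0 : f 0 = 0 by have /= := fZ 0 0; rewrite !scale0r.
elim: s c => [|v s IH] [|a c];
  rewrite ?big_nil //; last by rewrite !big_cons f_lin IH.
Qed.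

Lemma quad_expand (K : fieldType) (I : finType) (u : quadratic K I) q :
  u q = \sum_i \sum_j u (inl (i, j)) * lcomp K i j q
      + \sum_i \sum_j u (inr (i, j)) * rcomp K i j q.
Proof.
rewrite (pair_bigA _ (fun i j => u (inl (i, j)) * lcomp K i j q)).
rewrite (pair_bigA _ (fun i j => u (inr (i, j)) * rcomp K i j q)) /=.
case: q => -[i j]; [|rewrite addrC];
  rewrite (bigD1 (i, j)) //= !ffunE eqxx mulr1 !big1 ?addr0 //.
- by move=> p _; rewrite ffunE mulr0.
- by move=> [k l] p; rewrite ffunE (inj_eq (@inl_inj _ _)) eq_sym (negPf p) mulr0.
- by move=> p _; rewrite ffunE mulr0.
- by move=> [k l] p; rewrite ffunE (inj_eq (@inr_inj _ _)) eq_sym (negPf p) mulr0.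
Qed.

(** Each vector of [rs] imposes one linear equation, which lowers the dimension by at most one. The
    induction is on [rs] for all [V], since the first equation replaces [V] by a smaller
    subspace. *)
Lemma leq_dim_orthov_span (K : fieldType) (I : finType) (V : {vspace quadratic K I})
    (rs : seq (quadratic K I)) :
  (\dim V <= \dim (V :&: orthov (@koszul_form K I) <<rs>>) + size rs)%N.
Proof.
elim: rs V => [|r rs IH] V.
  by rewrite span_nil orthov0 capvf addn0.
have -> : (V :&: orthov (@koszul_form K I) <<r :: rs>> =
    (V :&: orthov (@koszul_form K I) <[r]>) :&: orthov (@koszul_form K I) <<rs>>)%VS.
  rewrite -capvA; congr (_ :&: _)%VS; apply/vspaceP => u; rewrite memv_cap -span_seq1.
  apply/orthov_spanP/andP => [u0|[/orthov_spanP u1 /orthov_spanP u0] v].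
    by split; apply/orthov_spanP => v; rewrite ?inE => vr; apply: u0;
      rewrite inE vr ?orbT.
  by rewrite inE => /predU1P[->|/u0//]; apply: u1; rewrite mem_head.
rewrite /= addnS; apply: leq_trans (leqSpred _) _; rewrite ltnS.
by apply: leq_trans (IH _); exact: leq_dim_orthov1.
Qed.

Lemma dim_quadratic (K : fieldType) (I : finType) :
  \dim {:quadratic K I} = #|{: (I * I) + (I * I)}|.
Proof. by rewrite dimvf -[RHS]muln1. Qed.

(** * The relations of the operads X and their self-duality *)

Section Relators.
Variables (K : fieldType) (e : K).
Local Notation Lq := (@lcomp K (bool * bool)%type).
Local Notation Rq := (@rcomp K (bool * bool)%type).
Local Notation form := (@koszul_form K (bool * bool)%type).
Implicit Types (V W : lmodType K).

(* With the basis vectors for [L] and [R] these are the relators of X^+ (e = 1)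
   and X^- (e = -1); with the values of the two compositions in an algebra,
   they are the defects of the defining identities. *)
Definition relators V (L R : bool * bool -> bool * bool -> V) : seq V :=
  [:: L nw nw - (R nw nw + R nw sw);
      L sw nw - R sw nw;
      (L nw sw + L sw sw) - R sw sw;

      L nw nw - (R nw se + R nw ne);
      L sw nw - R sw ne;
      (L nw sw + L sw sw) - R sw se;

      L ne nw - (R ne nw + R ne sw);
      L se nw - R se nw;
      (L ne sw + L se sw) - R se sw;

      L nw ne - (R ne ne + R ne se);
      L sw ne - R se ne;
      (L nw se + L sw se) - R se se;

      L ne ne - (R ne ne + R ne se);
      L se ne - R se ne;
      (L ne se + L se se) - R se se;

      (L ne se - L nw se) - e *: (R nw sw - R nw se)].

Lemma map_relators V W (f : V -> W) L R : linear f ->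
  map f (relators L R) = relators (fun i j => f (L i j)) (fun i j => f (R i j)).
Proof.
move=> /linear_morphs[fD fN fZ].
by rewrite /relators /= !(fD, fN, fZ).
Qed.

(** The default value 0 covers the indices out of range, so [k] needs no bound. *)
Lemma relators_nth0 V (L R : bool * bool -> bool * bool -> V) :
  {in relators L R, forall r, r = 0} -> forall k, nth 0 (relators L R) k = 0.
Proof.
move=> rel0 k; have [k16|k16] := leqP (size (relators L R)) k.
  by rewrite nth_default.
exact/rel0/mem_nth.
Qed.

(** The parameter [e] treats both signs at once; its value matters only for the self-duality. *)
Definition Xop : regular_operad K := @quotient_operad K (DendDias K)
  ((lcomp K ne se - lcomp K nw se) - e *: (rcomp K nw sw - rcomp K nw se)).

Lemma rels_X : rels Xop = <<relators Lq Rq>>%VS.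
Proof. by rewrite /Xop /= -span_seq1 -span_cat. Qed.

(** This exchanges the [Dend] index and the [Dias] index of a generator: it swaps [ne] and [sw] and
    fixes [nw] and [se]. *)
Definition swap_pair (p : bool * bool) := (p.2, p.1).

Lemma swap_pairK : involutive swap_pair.
Proof. by case. Qed.

Lemma eq_of_sub_eq0 (a b c : K) : c = 0 -> a - b = c -> a = b.
Proof. by move=> -> /eqP; rewrite subr_eq0 => /eqP. Qed.

(** The equations solved below are oriented so that the difference of the two sides is exactly the
    relator, which [ring] checks. *)
Ltac from_relation Ek :=
  refine (eq_of_sub_eq0 Ek _); rewrite /= /GRing.scale /=; ring.

(* The coefficients of the quadratic vector with coordinates [x i j] on
   (o_i)o_j and [y i j] on o_i(o_j), once relabelled by [swap_pair], on the
   sixteen relators: each relator but the last one has a coordinate in which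
   no other relator is involved. *)
Definition dual_coefs (x y : bool * bool -> bool * bool -> K) : seq K :=
  [:: - y nw nw; - y ne nw; - y ne ne; - y nw sw; - y ne sw; - y ne se;
      x sw nw; x se nw; x sw ne; x nw sw; x ne sw; x ne se;
      x sw sw; x se sw; x se se; x sw se - x se se].

(** The equations express sixteen of the coordinates [x], [y] by the other sixteen; after
    elimination the two sides agree identically. The arbitrary [l], [r] will be the values of the
    basis vectors at a fixed coordinate. *)
Lemma swap_relator (x y l r : bool * bool -> bool * bool -> K) :
  e = 1 \/ e = -1 ->
  {in @relators K^o x (fun i j => - y i j), forall a, a = 0} ->
  \sum_i \sum_j x (swap_pair i) (swap_pair j) * l i j
    + \sum_i \sum_j y (swap_pair i) (swap_pair j) * r i j =
  \sum_(p <- zip (dual_coefs x y) (@relators K^o l r)) p.1 * p.2.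
Proof.
move=> e1 /relators_nth0 E.
have sum_pair (F : bool * bool -> K) :
    \sum_i F i = F nw + F ne + F sw + F se.
  rewrite (eq_bigr (fun p => F (p.1, p.2))); last by case.
  by rewrite -(pair_bigA _ (fun a b => F (a, b))) /= !big_bool /=; ring.
rewrite !sum_pair /swap_pair /dual_coefs /relators /= !big_cons big_nil /=.
have E0 : y nw sw = - x nw nw - y nw nw by from_relation (E 0%N).
have E1 : y sw nw = - x sw nw by from_relation (E 1%N).
have E2 : y sw sw = - x nw sw - x sw sw by from_relation (E 2%N).
have E3 : y nw ne = - x nw nw - y nw se by from_relation (E 3%N).
have E4 : y sw ne = - x sw nw by from_relation (E 4%N).
have E5 : y sw se = - x nw sw - x sw sw by from_relation (E 5%N).
have E6 : y ne sw = - x ne nw - y ne nw by from_relation (E 6%N).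
have E7 : y se nw = - x se nw by from_relation (E 7%N).
have E8 : y se sw = - x ne sw - x se sw by from_relation (E 8%N).
have E9 : y ne se = - x nw ne - y ne ne by from_relation (E 9%N).
have E10 : y se ne = - x sw ne by from_relation (E 10%N).
have E11 : y se se = - x nw se - x sw se by from_relation (E 11%N).
have E12 : x ne ne = - y ne ne - y ne se by from_relation (E 12%N).
have E13 : x se ne = - y se ne by from_relation (E 13%N).
have E14 : x se se = - y se se - x ne se by from_relation (E 14%N).
have E15 : x ne se = x nw se + e * (y nw se - y nw sw) by from_relation (E 15%N).
rewrite /nw /ne /sw /se /wedge /vee /ldias /rdias
  in E0 E1 E2 E3 E4 E5 E6 E7 E8 E9 E10 E11 E12 E13 E14 E15 *.
(* The order matters: [E14] brings in [x ne se], solved by [E15], and these four equations bring in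
   values of [y] that the remaining ones eliminate. *)
rewrite E14 E15 E12 E13 E0 E1 E2 E3 E4 E5 E6 E7 E8 E9 E10 E11.
(* The sign enters through e^2 = 1: the last coefficient equals e (y nw se - y nw sw), and the last
   relator carries another factor e. *)
by case: e1 => ->; rewrite /GRing.scale /=; ring.
Qed.

Lemma relabel_orthov_X u : e = 1 \/ e = -1 ->
  u \in orthov form (rels Xop) ->
  relabel_quad swap_pair u \in rels Xop.
Proof.
rewrite rels_X => e1 /orthov_spanP u0.
pose x i j := u (inl (i, j)); pose y i j := u (inr (i, j)).
(* Pairing [u] with the relators gives the relators evaluated at its own coordinates; [y] gets a
   minus sign because the form is -1 on the vectors o_i(o_j). *)
have {}u0 : {in @relators K^o x (fun i j => - y i j), forall a, a = 0}.
  move=> a.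
  have -> : @relators K^o x (fun i j => - y i j) =
      map (koszul_form u) (relators Lq Rq).
    rewrite (@map_relators _ K^o) => [|b v w]; last first.
      by rewrite koszul_formD koszul_formZ.
    by congr relators; apply/funext=> i; apply/funext => j;
      rewrite ?koszul_form_lcomp ?koszul_form_rcomp.
  by case/mapP => r /u0 ur ->.
suff -> : relabel_quad swap_pair u =
  \sum_(p <- zip (dual_coefs x y) (relators Lq Rq)) p.1 *: p.2.
  exact: memv_span_comb.
(* Evaluation at [q] is linear, so it turns the relators into scalar ones and [swap_relator]
   applies. *)
apply/ffunP => q.
have ev_lin : linear (fun v : quadratic K (bool * bool)%type => v q : K^o).
  by move=> a v w; rewrite !ffunE.
rewrite (linear_comb _ _ ev_lin) (map_relators _ _ ev_lin).
rewrite -(swap_relator _ _ e1 u0) quad_expand.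
by congr (_ + _); apply: eq_bigr => i _; apply: eq_bigr => j _;
  rewrite [relabel_quad _ _ _]ffunE.
Qed.

Lemma rels_X_dual r : e = 1 \/ e = -1 ->
  r \in rels Xop ->
  relabel_quad swap_pair r \in orthov form (rels Xop).
Proof.
move=> e1; set R := rels Xop; set R' := orthov _ R.
pose f := linfun (@relabel_quad K (bool * bool)%type (bool * bool)%type swap_pair).
have fK : involutive f by move=> u; rewrite !lfunE /= relabel_quadK //; exact: swap_pairK.
have fR' : (f @: R' <= R)%VS.
  by apply/subvP => _ /memv_imgP[u uR' ->]; rewrite lfunE; exact: relabel_orthov_X.
have dimR' : (\dim R <= \dim (f @: R'))%N.
  rewrite limg_dim_eq; last first.
    by apply/eqP; rewrite (eqP (introT lker0P (inv_inj fK))) capv0.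
  (* The whole space has dimension 32 = 16 + 16 and there are 16 relators, so 16 bounds dim R from
     above and dim R' from below. *)
  have := leq_dim_orthov_span fullv (relators Lq Rq).
  rewrite -rels_X -/R -/R' capfv dim_quadratic card_sum !card_prod !card_bool /=.
  rewrite -[(_ * _ * _ + _)%N]/(16 + 16)%N leq_add2r; apply: leq_trans.
  by rewrite /R rels_X; exact: dim_span.
have /eqP fRE : (f @: R' == R)%VS by rewrite eqEdim fR' dimR'.
(* Writing [r] as [f u] with [u] in R', the involution gives back [u] as the image of [r]. *)
by rewrite -{1}fRE => /memv_imgP[u uR' ->]; have := fK u; rewrite !lfunE /= => ->.
Qed.

Lemma X_self_dual : e = 1 \/ e = -1 -> operad_iso Xop (koszul_dual Xop).
Proof.
move=> e1; apply: (@operad_iso_relabel K Xop (koszul_dual Xop) swap_pair swap_pair).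
- exact: swap_pairK.
- exact: swap_pairK.
- by move=> r; apply: rels_X_dual.
- by move=> r; apply: relabel_orthov_X.
Qed.

End Relators.

(** * Identities satisfied by X-algebras and by dendriform algebras *)

Section XAlgebras.
Variables (K : fieldType) (e : K) (A : lmodType K).
Local Notation Lq := (@lcomp K (bool * bool)%type).
Local Notation Rq := (@rcomp K (bool * bool)%type).

(** Evaluation is linear in the quadratic vector, so it commutes with the formation of the sixteen
    relators. *)
Lemma quad_eval_relators (o : bool * bool -> A -> A -> A) x y z :
  map (fun r => quad_eval o r x y z) (relators e Lq Rq) =
  relators e (fun i j => o j (o i x y) z) (fun i j => o i x (o j y z)).
Proof.
rewrite map_relators => [|a r r']; last by rewrite quad_evalD quad_evalZ.
by congr relators; apply/funext => i; apply/funext => j;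
  rewrite ?quad_eval_lcomp ?quad_eval_rcomp.
Qed.

Lemma X_relP (o : bool * bool -> A -> A -> A) x y z :
  {in rels (Xop e), forall r, quad_eval o r x y z = 0} <->
  {in relators e (fun i j => o j (o i x y) z) (fun i j => o i x (o j y z)),
     forall v, v = 0}.
Proof.
rewrite -quad_eval_relators rels_X; split=> [o0 _ /mapP[r rX ->]|o0].
  exact/o0/memv_span.
by apply: quad_eval_span => r rX; apply/o0/(map_f (fun r => quad_eval o r x y z)).
Qed.

End XAlgebras.

Lemma Dend_relP (K : fieldType) (A : lmodType K) (o : bool -> A -> A -> A) x y z :
  {in rels (Dend K), forall r, quad_eval o r x y z = 0} <->
  [/\ o wedge (o wedge x y) z = o wedge x (o wedge y z) + o wedge x (o vee y z),
      o wedge (o vee x y) z = o vee x (o wedge y z)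
    & o vee (o wedge x y) z + o vee (o vee x y) z = o vee x (o vee y z)].
Proof.
split=> [o0|[r1 r2 r3]].
  have rel r' : r' \in _ -> _ := fun h => o0 r' (memv_span h).
  have := rel (lcomp K wedge wedge - (rcomp K wedge wedge + rcomp K wedge vee)).
  have := rel (lcomp K vee wedge - rcomp K vee wedge).
  have := rel (lcomp K wedge vee + lcomp K vee vee - rcomp K vee vee).
  rewrite !inE !eqxx ?orbT /=.
  rewrite !(quad_evalD, quad_evalN, quad_eval_lcomp, quad_eval_rcomp).
  by move=> /(_ isT)/subr0_eq r3 /(_ isT)/subr0_eq r2 /(_ isT)/subr0_eq r1.
apply: quad_eval_span => r; rewrite !inE => /or3P[] /eqP ->;
  rewrite !(quad_evalD, quad_evalN, quad_eval_lcomp, quad_eval_rcomp).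
- by rewrite r1 subrr.
- by rewrite r2 subrr.
- by rewrite r3 subrr.
Qed.

(** * The functors from [Dend] to X and from X to [Dias] *)

Section DendX.
Variables (K : fieldType) (e : K).

Section Object.
Variables (A : lmodType K) (a : algebra (Dend K) A).

Definition fst_op (i : bool * bool) : A -> A -> A := a i.1.

Fact fst_op_bilinear i : bilinear_for *:%R *:%R (fst_op i).
Proof. exact: op_bilinear. Qed.

Fact fst_op_rel r :
  r \in rels (Xop e) -> forall x y z, quad_eval fst_op r x y z = 0.
Proof.
move=> rX x y z; move: r rX; apply/X_relP.
have [|r1 r2 r3] := (Dend_relP a x y z).1; first by move=> r /op_rel; apply.
have in_all (s : seq A) : all (eq_op^~ 0) s -> {in s, forall v, v = 0}.
  by move=> /allP s0 v /s0/eqP.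
(* The fourth relator lists the two terms of the first dendriform relation in the other order. In
   the sixteenth both differences vanish, since [nw] = [ne] and [sw] = [se]. *)
apply: in_all; rewrite /fst_op /= [a wedge x (a vee y z) + _]addrC.
by rewrite r1 r2 r3 !subrr scaler0 subrr eqxx.
Qed.

Definition Dend_X_alg : algebra (Xop e) A :=
  @Algebra K (Xop e) A fst_op fst_op_bilinear fst_op_rel.

End Object.

Fact Dend_X_morphism (A B : lmodType K) (a : algebra (Dend K) A)
  (b : algebra (Dend K) B) (f : {linear A -> B}) :
  alg_morphism a b f -> alg_morphism (Dend_X_alg a) (Dend_X_alg b) f.
Proof. by move=> fm i; exact: fm. Qed.

Definition Dend_X : alg_functor (Dend K) (Xop e) := AlgFunctor Dend_X_morphism.

End DendX.

Section XDias.
Variables (K : fieldType) (e : K).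

Section Object.
Variables (A : lmodType K) (b : algebra (Xop e) A).

Definition column_op (d : bool) (x y : A) : A := b (wedge, d) x y + b (vee, d) x y.

Fact column_op_bilinear d : bilinear_for *:%R *:%R (column_op d).
Proof.
have [wl wr] := op_bilinear b (wedge, d); have [vl vr] := op_bilinear b (vee, d).
split=> [v|u] c x y; rewrite /column_op /= scalerDr addrACA.
  by congr (_ + _); [exact: wl | exact: vl].
by congr (_ + _); [exact: wr | exact: vr].
Qed.

Lemma X_nth_rel k x y z :
  nth 0 (relators e (fun i j => b j (b i x y) z) (fun i j => b i x (b j y z))) k = 0.
Proof.
by apply: relators_nth0; apply: (X_relP e b x y z).1 => r /op_rel; apply.
Qed.

(** Expanded in the four operations, each diassociative relation is the sum of three consecutive
    relators, those of one row of the table. *)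
Fact column_op_rel r :
  r \in rels (Dias K) -> forall x y z, quad_eval column_op r x y z = 0.
Proof.
move=> rD x y z; apply: quad_eval_span rD => {}r.
have E k := X_nth_rel k x y z.
have colE i j : column_op j (column_op i x y) z =
    b (wedge, j) (b (wedge, i) x y) z + b (wedge, j) (b (vee, i) x y) z
    + (b (vee, j) (b (wedge, i) x y) z + b (vee, j) (b (vee, i) x y) z).
  by rewrite /column_op !op_addl.
have colE' i j : column_op i x (column_op j y z) =
    b (wedge, i) x (b (wedge, j) y z) + b (wedge, i) x (b (vee, j) y z)
    + (b (vee, i) x (b (wedge, j) y z) + b (vee, i) x (b (vee, j) y z)).
  by rewrite /column_op !op_addr.
rewrite !inE => /or4P[||| /orP[]] /eqP ->;
  rewrite quad_evalD quad_evalN quad_eval_lcomp quad_eval_rcomp colE colE';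
  apply/eqP; rewrite subr_eq0; apply/eqP.
- by rewrite (subr0_eq (E 0%N)) (subr0_eq (E 1%N)) (subr0_eq (E 2%N)) -!addrA.
- rewrite (subr0_eq (E 3%N)) (subr0_eq (E 4%N)) (subr0_eq (E 5%N)).
  by rewrite [_ + b nw _ _]addrC -!addrA.
- by rewrite (subr0_eq (E 6%N)) (subr0_eq (E 7%N)) (subr0_eq (E 8%N)) -!addrA.
- by rewrite (subr0_eq (E 9%N)) (subr0_eq (E 10%N)) (subr0_eq (E 11%N)) -!addrA.
- by rewrite (subr0_eq (E 12%N)) (subr0_eq (E 13%N)) (subr0_eq (E 14%N)) -!addrA.
Qed.

Definition X_Dias_alg : algebra (Dias K) A :=
  @Algebra K (Dias K) A column_op column_op_bilinear column_op_rel.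

End Object.

Fact X_Dias_morphism (A B : lmodType K) (a : algebra (Xop e) A)
  (b : algebra (Xop e) B) (f : {linear A -> B}) :
  alg_morphism a b f -> alg_morphism (X_Dias_alg a) (X_Dias_alg b) f.
Proof. by move=> fm d x y; rewrite /= /column_op linearD !fm. Qed.

Definition X_Dias : alg_functor (Xop e) (Dias K) := AlgFunctor X_Dias_morphism.

End XDias.

(** The symmetries are [ne] = [nw] and [se] = [sw]. Under them the dendriform structure is recovered
    from [nw] and [sw]. *)
Lemma Dend_X_inclusion (K : fieldType) (e : K) : inclusion_arrow (Dend_X e).
Proof.
split=> [A B a b f fm i|].
  exact: (fm (i, ldias)).
exists (fun s => exists p, s = Symmetry (p, rdias) (p, ldias) false false).
move=> A b; split=> [sym|[a ab] _ [p ->] x y]; last first.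
  by rewrite expr0 scale1r /= -!ab.
have o_rel r : r \in rels (Dend K) -> forall x y z,
    quad_eval (fun p => b (p, ldias)) r x y z = 0.
  (* The first three relators involve only [nw] and [sw], and are the dendriform relations for
     them. *)
  move=> rD x y z; move: r rD; apply/Dend_relP; have E k := X_nth_rel b k x y z.
  by split; [exact: subr0_eq (E 0%N)|exact: subr0_eq (E 1%N)|exact: subr0_eq (E 2%N)].
exists (@Algebra K (Dend K) A (fun p => b (p, ldias))
  (fun p => op_bilinear b (p, ldias)) o_rel).
move=> [p []] x y //.
by have /(_ x y) := sym _ (ex_intro _ p erefl); rewrite /symmetric /= expr0 scale1r.
Qed.

Lemma X_Dias_addition (K : fieldType) (e : K) : addition_arrow (X_Dias e).
Proof. by move=> d; exists (wedge, d), (vee, d), false, false. Qed.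

Theorem theorem4p1 (K : fieldType) (X : regular_operad K) :
  X = Xplus K \/ X = Xminus K ->
  [/\ has_dim (operations X 2) 8,
      operad_iso X (koszul_dual X)
    & exists (F : alg_functor (Dend K) X) (G : alg_functor X (Dias K)),
      [/\ inclusion_arrow F,
          addition_arrow G
        & eq_functor (comp_functor G F) (comp_functor (As_Dias K) (Dend_As K))]].
Proof.
move=> XE; have {XE} [e [e1 ->]] : exists e : K, (e = 1 \/ e = -1) /\ X = Xop e.
  case: XE => ->; [exists 1; split; first by left|exists (-1); split; first by right].
    by rewrite /Xop scale1r.
  by rewrite /Xop scaleN1r opprD opprK.
split.
- have := has_dim_operations2 (Xop e).
  (* Four generators, each in two orders. *)
  by rewrite card_prod /= card_prod !card_bool.
- exact: X_self_dual.
exists (Dend_X e), (X_Dias e).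
(* Commutativity holds by computation: both composites give [wedge] + [vee] for each of the two
   diassociative products. *)
by split; [exact: Dend_X_inclusion|exact: X_Dias_addition|].
Qed.
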